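(* Let $\mathbb{H}$ be an ordered connected hypergraph. Then the term rewriting system $(\Sigma^c_{\mathbb{H}},R^c_{\mathbb{H}})$ on constructions of $\mathbb{H}$ is confluent and terminating.
   Context: **Hypergraphs.** A hypergraph $\mathbb{H}$ consists of a finite set $H$ of vertices and a set $\mathbb{H}\subseteq\mathcal{P}(H)\setminus\{\emptyset\}$ of hyperedges with $\bigcup\mathbb{H}=H$; it is always assumed atomic, i.e. $\{x\}\in\mathbb{H}$ for all $x\in H$. It is ordered if $H$ carries a total order. For $X\subseteq H$ put $\mathbb{H}_X=\{Z\in\mathbb{H}\mid Z\subseteq X\}$ and $\mathbb{H}\setminus X=\mathbb{H}_{H\setminus X}$. $\mathbb{H}$ is connected if $H\neq\emptyset$ and there is no partition $H=X_1\sqcup X_2$ into non-empty sets with $\mathbb{H}=\mathbb{H}_{X_1}\cup\mathbb{H}_{X_2}$. A non-empty $X\subseteq H$ is called connected if $\mathbb{H}_X$ is connected. Every hypergraph decomposes uniquely into connected components. The notation $\mathbb{H},X\leadsto H_1,\dots,H_n$ means that $H_1,\dots,H_n$ are the (vertex sets of the) connected components of $\mathbb{H}\setminus X$, listed by increasing order of their maximal vertices. **Signature $\Sigma^c_{\mathbb{H}}$** (many-sorted). Sorts: the connected subsets of $H$. Variables: exactly one variable for each connected subset $Y$ of $H$, denoted $Y$ and of sort $Y$. Function symbols: pairs $(x,Y)$ with $Y\subseteq H$ connected and $x\in Y$; if $\mathbb{H}_Y,\{x\}\leadsto Y_1,\dots,Y_n$, then $(x,Y)$ has arity $n$, output sort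 $Y$, and its $i$-th argument has sort $Y_i$. Terms are the well-sorted terms built from these data. **Rules $R^c_{\mathbb{H}}$.** For each connected $K\subseteq H$ and each $x,y\in K$ with $x<y$, let $K_y$ be the connected component of $\mathbb{H}_K\setminus\{x\}$ containing $y$, and $K_x$ the connected component of $\mathbb{H}_K\setminus\{y\}$ containing $x$. Let $A_1,\dots,A_a$ be the components of $\mathbb{H}_K\setminus\{x\}$ not containing $y$; $B_1,\dots,B_b$ the components of $\mathbb{H}_{K_y}\setminus\{y\}$; $C_1,\dots,C_c$ the components of $\mathbb{H}_K\setminus\{y\}$ not containing $x$; $D_1,\dots,D_d$ the components of $\mathbb{H}_{K_x}\setminus\{x\}$ (so $\{A_i\}\cup\{B_i\}=\{C_i\}\cup\{D_i\}$ is the set of components of $\mathbb{H}_K\setminus\{x,y\}$). The rule is $$(x,K)(A_1,\dots,A_a,(y,K_y)(B_1,\dots,B_b))\to (y,K)(C_1,\dots,C_c,(x,K_x)(D_1,\dots,D_d)),$$ where the $A_i,B_i,C_i,D_i$ are variables and arguments are written up to the reordering prescribed by the signature. **Rewriting.** A rewriting step is $C[\sigma(l)]\to C[\sigma(r)]$ for a rule $l\to r$, a (sort-preserving) substitution $\sigma$ and a one-hole context $C$. Terminating: no infinite sequence of rewriting steps. Confluent: whenever $t_1\,{}^*\!\!\leftarrow s\to^* t_2$ there is a term $t$ with $t_1\to^* t\,{}^*\!\!\leftarrow t_2$. *)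

(* Defs.v *)
From Stdlib Require Export Relation_Operators.
From mathcomp Require Export all_boot all_order.

Set Implicit Arguments.
Unset Strict Implicit.
Unset Printing Implicit Defensive.

Section Hypergraph.
Variable T : finType.
Implicit Types (E P : {set {set T}}) (V X Y Z : {set T}).

(* The vertex set is the whole of T. The family H_X is MathComp's [E ::&: X]. *)
Definition hypergraph E : Prop := set0 \notin E /\ cover E = [set: T].

Definition atomic E : Prop := forall x : T, [set x] \in E.

(* Here V is the vertex set, not necessarily the whole of T. *)
Definition connected V E : bool :=
  (V != set0) &&
  ~~ [exists X1 : {set T}, exists X2 : {set T},
       [&& X1 != set0, X2 != set0, [disjoint X1 & X2], X1 :|: X2 == V
         & E == (E ::&: X1) :|: (E ::&: X2)]].

Definition connected_set E X : bool := connected X (E ::&: X).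

(* Vertex sets of the connected components of H_X, as the maximal connected
   subsets of X; [decompositionE] below identifies them with the blocks of the
   unique decomposition of H_X into connected hypergraphs. *)
Definition components E X : {set {set T}} :=
  [set Y | maxset (fun Z => (Z \subset X) && connected_set E Z) Y].

Definition decomposition E X P : bool :=
  [&& partition P X, E ::&: X == \bigcup_(Y in P) (E ::&: Y)
    & [forall Y in P, connected_set E Y]].

Lemma decomposition_max E X P Y :
  decomposition E X P -> Y \subset X -> connected_set E Y ->
  exists2 B, B \in P & Y \subset B.
Proof.
case/and3P => partP /eqP EX _ sYX /andP[/set0Pn[y Yy] nsplit].
have /and3P[/eqP covP tiP _] := partP.
have : y \in cover P by rewrite covP (subsetP sYX).
case/bigcupP => B PB By; exists B => //.
apply: contraR nsplit => nYB; apply/existsP; exists (Y :&: B).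
apply/existsP; exists (Y :\: B); apply/and5P; split.
- by apply/set0Pn; exists y; rewrite inE Yy.
- by rewrite setD_eq0.
- by rewrite -setI_eq0; apply/eqP/setP => z; rewrite !inE; do 2!case: (_ \in _).
- by rewrite setID.
apply/eqP/setP => Z; rewrite !inE.
have [EZ /=|//] := boolP (Z \in E).
have [sZY /=|//] := boolP (Z \subset Y).
apply/esym.
have : Z \in E ::&: X by rewrite !inE EZ (subset_trans sZY).
rewrite EX => /bigcupP[C PC]; rewrite inE => /andP[_ sZC].
have [<-|neq] := eqVneq C B; first by rewrite subsetI sZY sZC.
apply/orP; right; rewrite subsetD sZY /=.
have dCB := trivIsetP tiP C B PC PB neq.
exact: disjointWl sZC dCB.
Qed.

Lemma decomposition_exists E X : set0 \notin E -> exists P, decomposition E X P.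
Proof.
move=> E0; have [n] := ubnP #|X|; elim: n X => // n IHn X.
rewrite ltnS => leXn.
have [->|nX] := eqVneq X set0.
  exists set0; apply/and3P; split.
  - by rewrite /partition /trivIset /cover !big_set0 cards0 !inE !eqxx.
  - rewrite big_set0; apply/eqP/setP => Z; rewrite !inE subset0 andbC.
    by case: eqP => // ->; rewrite (negPf E0).
  - by apply/forall_inP => Y; rewrite inE.
have [cX|] := boolP (connected_set E X).
  exists [set X]; apply/and3P; split.
  - by rewrite /partition /trivIset /cover !big_set1 !inE eq_sym nX !eqxx.
  - by rewrite big_set1.
  - by apply/forall_inP => Y; rewrite inE => /eqP->.
rewrite /connected_set /connected nX negbK => /existsP[X1 /existsP[X2]].
case/and5P => nX1 nX2 dX /eqP defX /eqP EX.
have ltX1 : #|X1| < #|X|.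
  by rewrite -defX cardsU disjoint_setI0 // cards0 subn0 -[ltnLHS]addn0
    ltn_add2l card_gt0.
have ltX2 : #|X2| < #|X|.
  by rewrite -defX cardsU disjoint_setI0 // cards0 subn0 -[ltnLHS]add0n
    ltn_add2r card_gt0.
have [P1 /and3P[/and3P[/eqP cP1 tP1 P10] /eqP E1 /forall_inP c1]] :=
  IHn X1 (leq_trans ltX1 leXn).
have [P2 /and3P[/and3P[/eqP cP2 tP2 P20] /eqP E2 /forall_inP c2]] :=
  IHn X2 (leq_trans ltX2 leXn).
have in1 B : B \in P1 -> B \subset X1.
  by move=> PB; rewrite -cP1 /cover (bigcup_max B).
have in2 B : B \in P2 -> B \subset X2.
  by move=> PB; rewrite -cP2 /cover (bigcup_max B).
exists (P1 :|: P2); apply/and3P; split.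
- apply/and3P; split; last by rewrite inE negb_or P10.
    by rewrite /cover bigcup_setU -/(cover P1) -/(cover P2) cP1 cP2 defX.
  apply/trivIsetP => A B /setUP[PA|PA] /setUP[PB|PB] neq.
  + exact: (trivIsetP tP1).
  + exact: disjointW (in1 _ PA) (in2 _ PB) dX.
  + by rewrite disjoint_sym; apply: disjointW (in1 _ PB) (in2 _ PA) dX.
  + exact: (trivIsetP tP2).
- rewrite bigcup_setU -E1 -E2; apply/eqP/setP => Z.
  rewrite EX !inE -defX.
  have [sZ1|_] := boolP (Z \subset X1).
    by rewrite (subset_trans sZ1 (subsetUl _ _)) /= !andbT.
  have [sZ2|_] := boolP (Z \subset X2); last by rewrite !andbF.
  by rewrite (subset_trans sZ2 (subsetUr _ _)) /= !andbT.
- by apply/forall_inP => Y /setUP[/c1|/c2].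
Qed.

Lemma decomposition_components E X P :
  decomposition E X P -> P = components E X.
Proof.
move=> decP; have /and3P[/and3P[/eqP cP tP P0] _ /forall_inP conP] := decP.
have inX B : B \in P -> B \subset X.
  by move=> PB; rewrite -cP /cover (bigcup_max B).
apply/setP => B; rewrite inE; apply/idP/maxsetP => [PB|[/andP[sBX cB] maxB]].
  split=> [|C /andP[sCX cC] sBC]; first by rewrite inX // conP.
  have [D PD sCD] := decomposition_max decP sCX cC.
  suff eqBD : B = D by apply/eqP; rewrite eqEsubset sBC andbT eqBD.
  apply/eqP; apply: contraT => neq.
  have /disjoint_setI0 := trivIsetP tP B D PB PD neq.
  rewrite (setIidPl (subset_trans sBC sCD)) => B0.
  by rewrite -B0 PB in P0.
have [D PD sBD] := decomposition_max decP sBX cB.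
by rewrite -(maxB D) // inX // conP.
Qed.

Lemma decompositionE E X P :
  set0 \notin E -> decomposition E X P = (P == components E X).
Proof.
move=> E0; apply/idP/eqP => [/decomposition_components//|->].
by have [Q decQ] := decomposition_exists X E0; rewrite -(decomposition_components decQ).
Qed.

End Hypergraph.

Section Rewriting.
Variables (d : Order.disp_t) (T : finOrderType d) (E : {set {set T}}).
Implicit Types (x y : T) (K X Y Z : {set T}).

Definition is_max_vertex X x : bool := (x \in X) && [forall y in X, (y <= x)%O].

Definition max_vertex_le X Y : bool :=
  [exists x, exists y, [&& is_max_vertex X x, is_max_vertex Y y & (x <= y)%O]].

(* [component_seq X] is the sequence H_1, ..., H_n with
   H_X, {} ~> H_1, ..., H_n. *)
Definition component_seq X : seq {set T} :=
  sort max_vertex_le (enum (components E X)).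

(* Raw terms: [Var Y] is the variable of sort Y and [App x Y ts] applies the
   function symbol (x, Y). *)
Inductive raw_term : Type :=
  | Var of {set T}
  | App of T & {set T} & seq raw_term.

Definition sort_of (t : raw_term) : {set T} :=
  match t with Var Y => Y | App _ Y _ => Y end.

Fixpoint well_sorted (t : raw_term) : bool :=
  match t with
  | Var Y => connected_set E Y
  | App x Y ts =>
      [&& connected_set E Y, x \in Y,
          map sort_of ts == component_seq (Y :\ x) & all well_sorted ts]
  end.

Definition term : Type := {t : raw_term | well_sorted t}.

Definition sort_preserving (sigma : {set T} -> raw_term) : Prop :=
  forall Y, connected_set E Y ->
    well_sorted (sigma Y) /\ sort_of (sigma Y) = Y.

Fixpoint subst (sigma : {set T} -> raw_term) (t : raw_term) : raw_term :=
  match t with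
  | Var Y => sigma Y
  | App x Y ts => App x Y (map (subst sigma) ts)
  end.

Inductive context : Type :=
  | Hole
  | CApp of T & {set T} & seq raw_term & context & seq raw_term.

Fixpoint plug (C : context) (t : raw_term) : raw_term :=
  match C with
  | Hole => t
  | CApp x Y ts1 C' ts2 => App x Y (ts1 ++ plug C' t :: ts2)
  end.

(* The term (x, K)(A_1, ..., A_a, (y, K_y)(B_1, ..., B_b)), with arguments in
   the order of the signature: K_y is the only component Z of K \ {x} that
   contains y. The other side of the rule is the same term with x and y
   exchanged. *)
Definition rule_side K x y : raw_term :=
  App x K [seq if y \in Z then App y Z (map Var (component_seq (Z :\ y)))
               else Var Z | Z <- component_seq (K :\ x)].

Inductive rule : raw_term -> raw_term -> Prop :=
  | Rule K x y : connected_set E K -> x \in K -> y \in K -> (x < y)%O ->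
      rule (rule_side K x y) (rule_side K y x).

Lemma sort_of_rule_side_args K x y :
  map sort_of [seq if y \in Z then App y Z (map Var (component_seq (Z :\ y)))
               else Var Z | Z <- component_seq (K :\ x)] = component_seq (K :\ x).
Proof. by rewrite -map_comp map_id_in // => Z _ /=; case: ifP. Qed.

Lemma mem_component_seq X Y : Y \in component_seq X -> connected_set E Y.
Proof.
by rewrite mem_sort mem_enum inE => /maxsetP[/andP[]].
Qed.

Lemma well_sorted_rule_side K x y :
  connected_set E K -> x \in K -> well_sorted (rule_side K x y).
Proof.
move=> cK Kx /=; rewrite cK Kx sort_of_rule_side_args eqxx /=.
rewrite all_map; apply/allP => Z /mem_component_seq cZ /=.
case: ifP => //= Zy; rewrite cZ Zy -map_comp map_id eqxx /=.
by rewrite all_map; apply/allP => B /mem_component_seq.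
Qed.

Lemma well_sorted_subst sigma t : sort_preserving sigma -> well_sorted t ->
  well_sorted (subst sigma t) /\ sort_of (subst sigma t) = sort_of t.
Proof.
move=> sP; move: t; fix IH 1 => -[Y|x Y ts] /=; first exact: sP.
case/and4P => -> -> /eqP <- wts; split=> //=.
elim: ts wts => //= t ts IHts /andP[/IH[-> ->] /IHts/andP[/eqP-> ->]].
by rewrite eqxx.
Qed.

Lemma well_sorted_plug C t u : sort_of t = sort_of u -> well_sorted u ->
  well_sorted (plug C t) -> well_sorted (plug C u).
Proof.
move=> eqtu wu; suff: well_sorted (plug C t) ->
    well_sorted (plug C u) /\ sort_of (plug C t) = sort_of (plug C u).
  by move=> H /H[].
elim: C => //= x Y ts1 C IH ts2 /and3P[-> ->].
case/andP=> + /[!all_cat] /= /and3P[-> /IH[-> eqs] ->].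
by rewrite !map_cat /= eqs => ->.
Qed.

(* Rewriting a well-sorted term yields a well-sorted term, so that [step] below
   does not lose any step by relating two well-sorted terms. *)
Lemma well_sorted_rewrite l r sigma C : rule l r -> sort_preserving sigma ->
  well_sorted (plug C (subst sigma l)) -> well_sorted (plug C (subst sigma r)).
Proof.
case=> K x y cK Kx Ky _ sP; apply: well_sorted_plug => //.
by have [] := well_sorted_subst sP (well_sorted_rule_side x cK Ky).
Qed.

Definition step (s t : term) : Prop :=
  exists l r sigma C,
    [/\ rule l r, sort_preserving sigma,
        sval s = plug C (subst sigma l) & sval t = plug C (subst sigma r)].

End Rewriting.

Definition terminating (A : Type) (R : A -> A -> Prop) : Prop :=
  ~ exists f : nat -> A, forall n, R (f n) (f n.+1).

Definition confluent (A : Type) (R : A -> A -> Prop) : Prop :=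
  forall s t1 t2, clos_refl_trans A R s t1 -> clos_refl_trans A R s t2 ->
  exists2 t, clos_refl_trans A R t1 t & clos_refl_trans A R t2 t.

(* Main.v *)
Require Import Defs.

(** Every rule lifts the larger of two adjacent vertices above the smaller one.

    Termination. A step at the root of a term of sort K replaces the root by a
    larger vertex and rearranges the arguments, whose sorts are strictly smaller
    than K; any other step leaves the root alone. So a term decreases
    lexicographically from the root downwards, which [weight] records in base
    [weight_base]: a node (x, Y) has the digit #{z | x < z} at position #|Y|,
    and [weight_args_lt] says that all the arguments together weigh less than
    one unit at the position of the root.

    Confluence. No critical pair is examined. A step preserves the sort of a
    term and the set of vertices occurring in it ([steps_invariant]); for the
    latter, the components of K \ {x, y} are obtained by deleting x and y in
    either order ([components_delete]). The left-hand sides are linear and match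
    every pair of a node x with a child y such that x < y ([redex_match]), so a
    term without redex decreases along its branches. Such a term is determined by
    its sort and its vertices ([decreasing_unique]): the root has to be the
    largest vertex, which fixes the sorts of the arguments, and the vertices of
    each argument are those lying in its sort. By termination any two reducts of
    a term s reach decreasing terms, and these agree because both have the sort
    and the vertices of s. *)

Set Implicit Arguments.
Unset Strict Implicit.
Unset Printing Implicit Defensive.

Import Order.TTheory.

(** * Connected components after deleting a vertex *)

Section Components.
Variables (T : finType) (E : {set {set T}}).
Hypothesis E0 : set0 \notin E.
Implicit Types (X Y Z : {set T}) (P Q : {set {set T}}).

Lemma components_decomposition X : decomposition E X (components E X).
Proof. by rewrite decompositionE. Qed.

Lemma components_partition X : partition (components E X) X.
Proof. by have /and3P[] := components_decomposition X. Qed.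

Lemma components_sub X Y : Y \in components E X -> Y \subset X.
Proof. by rewrite inE => /maxsetP[/andP[]]. Qed.

Lemma components_meet X Y Z u :
  Y \in components E X -> Z \in components E X -> u \in Y -> u \in Z -> Y = Z.
Proof.
have /and3P[_ tiP _] := components_partition X => XY XZ Yu Zu.
by rewrite -(def_pblock tiP XY Yu) (def_pblock tiP XZ Zu).
Qed.

Lemma components_exists X u :
  u \in X -> exists2 Y, Y \in components E X & u \in Y.
Proof.
have /and3P[/eqP cX _ _] := components_partition X.
by rewrite -{1}cX => /bigcupP[Y]; exists Y.
Qed.

(** A hyperedge avoiding u lies in a single block of P: if that block is Z, the
    hyperedge is split further by Q, and otherwise it is left alone since u
    belongs to no other block. *)
Lemma decomposition_refine X P Z Q u :
  decomposition E X P -> Z \in P -> u \in Z -> decomposition E (Z :\ u) Q ->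
  decomposition E (X :\ u) (P :\ Z :|: Q).
Proof.
case/and3P => /and3P[/eqP cP tP P0] /eqP EX /forall_inP conP PZ Zu.
case/and3P => /and3P[/eqP cQ tQ Q0] /eqP EZ /forall_inP conQ.
have inQ B : B \in Q -> B \subset Z :\ u.
  by move=> QB; rewrite -cQ /cover (bigcup_max B).
have inX B : B \in P -> B \subset X.
  by move=> PB; rewrite -cP /cover (bigcup_max B).
have disjZ B : B \in P :\ Z -> [disjoint B & Z].
  by case/setD1P => neq PB; apply: (trivIsetP tP).
have disjQ A B : A \in P :\ Z -> B \in Q -> [disjoint A & B].
  move=> PA QB; apply: disjointWr (disjZ A PA).
  exact: subset_trans (inQ _ QB) (subD1set _ _).
apply/and3P; split.
- apply/and3P; split; last by rewrite !inE !negb_or negb_and P0 orbT.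
    apply/eqP/setP => v; rewrite /cover bigcup_setU -/(cover Q) cQ !inE.
    apply/orP/andP=> [[/bigcupP[B PB Bv]|/andP[-> Zv]]|[neq]].
    + have /setD1P[_ PB'] := PB; split; last exact: subsetP (inX _ PB') _ Bv.
      by apply: contraTneq Bv => ->; rewrite (disjointFl (disjZ _ PB)).
    + by split=> //; apply: subsetP (inX _ PZ) _ Zv.
    rewrite -cP => /bigcupP[B PB Bv]; have [eqBZ|neqB] := eqVneq B Z.
      by right; rewrite neq -eqBZ.
    by left; apply/bigcupP; exists B => //; apply/setD1P.
  apply/trivIsetP => A B /setUP[PA|QA] /setUP[PB|QB] neq.
  + by apply: (trivIsetP tP) => //; [case/setD1P: PA | case/setD1P: PB].
  + exact: disjQ.
  + by rewrite disjoint_sym; apply: disjQ.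
  + exact: (trivIsetP tQ).
- rewrite bigcup_setU -EZ; apply/eqP/setP => S; rewrite !inE !subsetD1.
  apply/andP/orP=> [[ES /andP[sSX nuS]]|].
    have : S \in E ::&: X by rewrite inE ES.
    rewrite EX => /bigcupP[B PB]; rewrite inE => /andP[_ sSB].
    have [eqBZ|neqB] := eqVneq B Z.
      by right; rewrite ES -eqBZ sSB.
    by left; apply/bigcupP; exists B; [apply/setD1P | rewrite inE ES].
  case=> [/bigcupP[B PB]|].
    rewrite inE => /andP[-> sSB]; split=> //.
    have /setD1P[_ PB'] := PB; rewrite (subset_trans sSB (inX _ PB')) /=.
    by apply: contraTN Zu => /(subsetP sSB) /(disjointFr (disjZ _ PB)) ->.
  by case/and3P=> -> sSZ nuS; rewrite (subset_trans sSZ) // inX.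
- by apply/forall_inP => Y /setUP[/setD1P[_ /conP]|/conQ].
Qed.

(** This is the identity {A_i} u {B_i} = components of K \ {x, y}, applied with
    X = K \ {x}; exchanging x and y gives the same set for the C_i and D_i. *)
Lemma components_delete X Z u : Z \in components E X -> u \in Z ->
  components E (X :\ u) = components E X :\ Z :|: components E (Z :\ u).
Proof.
move=> XZ Zu; apply/esym/eqP; rewrite -decompositionE //.
by apply: decomposition_refine XZ Zu _; apply: components_decomposition.
Qed.

End Components.

(** * Arguments of a well-sorted term *)

Arguments sort_of {d T} t.

Section Terms.
Variables (d : Order.disp_t) (T : finOrderType d) (E : {set {set T}}).
Hypothesis E0 : set0 \notin E.
Implicit Types (x y z u : T) (K V X Y Z : {set T}).
Implicit Types (s t : raw_term T) (ts us : seq (raw_term T)).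

Local Notation dflt := (@Var d T set0).

(** The principle generated for this nested inductive type has no hypothesis on
    the arguments. Access by position avoids any equality on raw terms, and it
    matches the i-th argument with the i-th component. *)
Lemma raw_term_nth_ind (P : raw_term T -> Prop) :
  (forall Y, P (Var Y)) ->
  (forall x Y ts, (forall i, i < size ts -> P (nth dflt ts i)) ->
     P (App x Y ts)) ->
  forall t, P t.
Proof.
move=> PVar PApp; fix IH 1 => -[Y|x Y ts]; first exact: PVar.
apply: PApp; elim: ts => [|t ts IHts] [|i] lti.
- by discriminate lti.
- by discriminate lti.
- exact: IH.
- exact: IHts.
Qed.

Lemma mem_component_seqE X Y : (Y \in component_seq E X) = (Y \in components E X).
Proof. by rewrite mem_sort mem_enum. Qed.

Lemma component_seq_uniq X : uniq (component_seq E X).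
Proof. by rewrite sort_uniq enum_uniq. Qed.

Lemma component_seq_nth_inj X Y0 i j u :
  i < size (component_seq E X) -> j < size (component_seq E X) ->
  u \in nth Y0 (component_seq E X) i -> u \in nth Y0 (component_seq E X) j ->
  i = j.
Proof.
move=> lti ltj ui uj; apply/eqP.
rewrite -(nth_uniq Y0 lti ltj (component_seq_uniq X)); apply/eqP.
by apply: (components_meet E0 (X := X) _ _ ui uj); rewrite -mem_component_seqE mem_nth.
Qed.

Section Arguments.
Variables (x : T) (K : {set T}) (ts : seq (raw_term T)).
Hypothesis wt : well_sorted E (App x K ts).

Lemma args_sorts : map sort_of ts = component_seq E (K :\ x).
Proof. by case/and4P: wt => _ _ /eqP. Qed.

Lemma args_size : size ts = size (component_seq E (K :\ x)).
Proof. by rewrite -args_sorts size_map. Qed.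

Lemma well_sorted_arg i : i < size ts -> well_sorted E (nth dflt ts i).
Proof. by case/and4P: wt => _ _ _ /(all_nthP dflt) wts /wts. Qed.

Lemma sort_of_arg i : i < size ts ->
  sort_of (nth dflt ts i) = nth set0 (component_seq E (K :\ x)) i.
Proof. by move=> lti; rewrite -args_sorts (nth_map dflt). Qed.

Lemma arg_component i : i < size ts ->
  sort_of (nth dflt ts i) \in components E (K :\ x).
Proof.
by move=> lti; rewrite sort_of_arg // -mem_component_seqE mem_nth // -args_size.
Qed.

Lemma arg_unique i j u : i < size ts -> j < size ts ->
  u \in sort_of (nth dflt ts i) -> u \in sort_of (nth dflt ts j) -> i = j.
Proof.
by move=> lti ltj; rewrite !sort_of_arg //; apply: component_seq_nth_inj;
  rewrite -args_size.
Qed.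

Lemma arg_sum : \sum_(t <- ts) #|sort_of t| = #|K :\ x|.
Proof.
rewrite (card_partition (components_partition E0 (K :\ x))).
rewrite -(big_map sort_of predT (fun Z => #|Z|)) args_sorts.
rewrite -[RHS]big_enum; apply: perm_big; exact/permPl/perm_sort.
Qed.

End Arguments.

(** * Termination *)

(** A term of sort K has at most #|K| nodes, each with a digit at most #|T|; the
    square leaves room for #|T| nodes of digit #|T| at a single position. *)
Definition weight_base := (#|T| * #|T|).+1.

(** Replacing a root by a larger vertex must outweigh any change to the
    arguments, whose sorts are strictly smaller: hence the power of the base. *)
Fixpoint weight t : nat :=
  match t with
  | Var _ => 0
  | App x Y ts =>
      #|[set z | (x < z)%O]| * weight_base ^ #|Y| + sumn (map weight ts)
  end.

Lemma weight_args_bound x K ts : well_sorted E (App x K ts) ->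
  (forall i, i < size ts ->
     let Z := sort_of (nth dflt ts i) in
     weight (nth dflt ts i) <= #|Z| * (#|T| * weight_base ^ #|Z|)) ->
  sumn (map weight ts) <= #|K :\ x| * (#|T| * weight_base ^ #|K :\ x|).
Proof.
move=> wt bound; rewrite -{1}(arg_sum wt) sumnE big_map big_distrl /=.
rewrite !(big_nth dflt) !big_nat; apply: leq_sum => i /andP[_ lti].
apply: leq_trans (bound i lti) _; rewrite !leq_mul2l leq_pexp2l ?orbT //.
exact: subset_leq_card (components_sub (arg_component wt lti)).
Qed.

Lemma weight_bound t : well_sorted E t ->
  weight t <= #|sort_of t| * (#|T| * weight_base ^ #|sort_of t|).
Proof.
elim/raw_term_nth_ind: t => //= x K ts IH wt.
have /and4P[_ Kx _ _] := wt.
have := weight_args_bound wt (fun i lti => IH i lti (well_sorted_arg wt lti)).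
rewrite (cardsD1 x K) Kx add1n mulSn => le_args.
apply: leq_add; first by rewrite leq_mul2r max_card orbT.
by apply: leq_trans le_args _; rewrite !leq_mul2l leq_pexp2l // !orbT.
Qed.

Lemma weight_args_lt x K ts : well_sorted E (App x K ts) ->
  sumn (map weight ts) < weight_base ^ #|K|.
Proof.
move=> wt; have /and4P[_ Kx _ _] := wt.
have le_args :=
  weight_args_bound wt (fun i lti => weight_bound (well_sorted_arg wt lti)).
apply: leq_ltn_trans le_args _.
rewrite (cardsD1 x K) Kx add1n expnS mulnA ltn_pmul2r ?expn_gt0 //.
by rewrite ltnS leq_mul2r max_card orbT.
Qed.

Lemma weight_plug (C : context T) s t :
  weight s < weight t -> weight (plug C s) < weight (plug C t).
Proof.
move=> lt_st; elim: C => //= x Y ts1 C IH ts2.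
by rewrite !map_cat !sumn_cat /= !ltn_add2l ltn_add2r.
Qed.

(** The digit of the root drops from #{z | x < z} to #{z | y < z}, and
    the new arguments weigh less than one unit of that digit. *)
Lemma weight_rule (l r : raw_term T) (sigma : {set T} -> raw_term T) :
  rule E l r -> sort_preserving E sigma ->
  weight (subst sigma r) < weight (subst sigma l).
Proof.
case=> K x y cK Kx Ky ltxy sP.
have [wr _] := well_sorted_subst sP (well_sorted_rule_side x cK Ky).
have {wr} := weight_args_lt wr; rewrite /=.
move: (sumn _) (sumn _) => a b lt_a; apply: leq_trans (leq_addr _ _).
rewrite -(ltn_add2l (#|[set z | (y < z)%O]| * weight_base ^ #|K|)) in lt_a.
apply: leq_trans lt_a _; rewrite addnC -mulSn leq_mul2r; apply/orP; right.
apply: proper_card; apply/properP; split.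
  by apply/subsetP => z; rewrite !inE; apply: lt_trans.
by exists y; rewrite !inE ?ltxy // ltxx.
Qed.

Lemma weight_step (s t : term E) : step s t -> weight (sval t) < weight (sval s).
Proof.
by case=> l [r [sigma [C [lr sP -> ->]]]]; apply/weight_plug/weight_rule.
Qed.

(** * The vertices of a term *)

Fixpoint occurs z t : bool :=
  match t with
  | Var _ => false
  | App x _ ts => (z == x) || has (occurs z) ts
  end.

(** The right-hand side is symmetric in x and y, up to the order of the two
    deletions: both sides of a rule have the same vertices. *)
Lemma occurs_rule_side (sigma : {set T} -> raw_term T) K x y z :
  x \in K -> y \in K -> x != y ->
  occurs z (subst sigma (rule_side E K x y)) =
  [|| z == x, z == y
    | [exists V in components E (K :\ x :\ y), occurs z (sigma V)]].
Proof.
move=> Kx Ky neq; have : y \in K :\ x by rewrite !inE eq_sym neq.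
case/(components_exists E0) => Z XZ Zy.
rewrite /= -map_comp has_map (components_delete E0 XZ Zy); congr (_ || _).
apply/hasP/orP=> [[V]|].
  rewrite mem_component_seqE => XV /=; case: ifP => Vy /=.
    rewrite -map_comp has_map => /orP[->|]; first by left.
    case/hasP => B; rewrite mem_component_seqE => VB zB; right.
    apply/exists_inP; exists B => //.
    by rewrite (components_meet E0 XZ XV Zy Vy) in_setU VB orbT.
  move=> zV; right; apply/exists_inP; exists V => //.
  by rewrite in_setU in_setD1 XV andbT (contraFneq _ Vy) // => ->.
case=> [/eqP->|/exists_inP[V /setUP[/setD1P[neqV XV]|ZV] zV]].
- by exists Z; rewrite ?mem_component_seqE //= Zy /= eqxx.
- exists V; rewrite ?mem_component_seqE //=.
  by case: ifP => // Vy; rewrite (components_meet E0 XV XZ Vy Zy) eqxx in neqV.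
exists Z; rewrite ?mem_component_seqE //= Zy /= -map_comp has_map.
by apply/orP; right; apply/hasP; exists V; rewrite ?mem_component_seqE.
Qed.

Lemma occurs_rule (l r : raw_term T) (sigma : {set T} -> raw_term T) z :
  rule E l r -> occurs z (subst sigma r) = occurs z (subst sigma l).
Proof.
case=> K x y _ Kx Ky ltxy; rewrite !occurs_rule_side ?(lt_eqF ltxy) //.
  by rewrite orbCA setDDl setUC -setDDl.
by rewrite gt_eqF.
Qed.

Lemma occurs_plug (C : context T) s t z :
  occurs z s = occurs z t -> occurs z (plug C s) = occurs z (plug C t).
Proof.
by move=> eq_st; elim: C => //= x Y ts1 C IH ts2; rewrite !has_cat /= IH.
Qed.

Lemma sort_of_plug (C : context T) s t :
  sort_of s = sort_of t -> sort_of (plug C s) = sort_of (plug C t).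
Proof. by case: C. Qed.

Lemma steps_invariant (s t : term E) : clos_refl_trans _ (@step d T E) s t ->
  sort_of (sval s) = sort_of (sval t) /\
  (forall z, occurs z (sval s) = occurs z (sval t)).
Proof.
elim=> {s t} [s t|s|s t u _ [-> eq1] _ [-> eq2]] //; last first.
  by split=> // z; rewrite eq1.
case=> l [r [sigma [C [lr sP -> ->]]]]; split=> [|z].
  by apply: sort_of_plug; case: lr.
by apply/occurs_plug/esym/occurs_rule.
Qed.

Lemma occurs_sort t z : well_sorted E t -> occurs z t -> z \in sort_of t.
Proof.
elim/raw_term_nth_ind: t => //= x K ts IH wt.
have /and4P[_ Kx _ _] := wt; case/orP=> [/eqP->//|/(has_nthP dflt)[i lti zi]].
have := IH i lti (well_sorted_arg wt lti) zi.
by move/(subsetP (components_sub (arg_component wt lti)))/setD1P => [].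
Qed.

(** The sorts of the arguments are disjoint and miss the root, so the vertices
    of each argument can be read off from those of the whole term. *)
Lemma occurs_arg x K ts i z : well_sorted E (App x K ts) -> i < size ts ->
  occurs z (nth dflt ts i) =
  (z \in sort_of (nth dflt ts i)) && occurs z (App x K ts).
Proof.
move=> wt lti; apply/idP/andP=> [zi|[Zz /=]].
  split; first exact: occurs_sort (well_sorted_arg wt lti) zi.
  by apply/orP; right; apply/(has_nthP dflt); exists i.
case/orP=> [/eqP zx|/(has_nthP dflt)[j ltj zj]].
  have /setD1P[] := subsetP (components_sub (arg_component wt lti)) _ Zz.
  by rewrite zx eqxx.
have Zj := occurs_sort (well_sorted_arg wt ltj) zj.
by rewrite (arg_unique wt lti ltj Zz Zj).
Qed.

(** * Decreasing terms *)

Definition root_below x t : bool :=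
  if t is App y _ _ then (y < x)%O else true.

Fixpoint decreasing t : bool :=
  match t with
  | Var _ => true
  | App x _ ts => all (root_below x) ts && all decreasing ts
  end.

Lemma decreasing_root_max x K ts z :
  decreasing (App x K ts) -> occurs z (App x K ts) -> (z <= x)%O.
Proof.
(* No vertex occurs in a variable, hence the false branch. *)
suff max_root t : decreasing t -> occurs z t ->
    if t is App x' _ _ then (z <= x')%O else false by apply: max_root.
elim/raw_term_nth_ind: t => //= {}x _ {}ts IH /andP[below dts].
case/orP=> [/eqP->//|/(has_nthP dflt)[i lti zi]].
have /(_ i lti) := all_nthP dflt below.
have := IH i lti (all_nthP dflt dts i lti) zi.
by case: (nth _ _ _) => //= y _ _ zy /ltW; apply: le_trans.
Qed.

(** The root is forced to be the largest vertex; the arguments then have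
    prescribed sorts, and each contains exactly the vertices lying in its sort. *)
Lemma decreasing_unique s t :
  well_sorted E s -> well_sorted E t -> decreasing s -> decreasing t ->
  sort_of s = sort_of t -> (forall z, occurs z s = occurs z t) -> s = t.
Proof.
elim/raw_term_nth_ind: s t => [Y|x K ts IH] [Y'|x' K' ts'].
- by move=> _ _ _ _ /= ->.
- by move=> _ _ _ _ _ /(_ x') /=; rewrite eqxx.
- by move=> _ _ _ _ _ /(_ x) /=; rewrite eqxx.
move=> ws wt ds dt eqK eq_occ; rewrite /= in eqK; rewrite -{K'}eqK in wt dt eq_occ *.
have eqx : x = x'.
  apply/le_anti/andP; split.
    by apply: (decreasing_root_max dt); rewrite -eq_occ /= eqxx.
  by apply: (decreasing_root_max ds); rewrite eq_occ /= eqxx.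
rewrite -{x'}eqx in wt dt eq_occ *; congr App.
have eq_size : size ts = size ts' by rewrite (args_size ws) (args_size wt).
apply: (@eq_from_nth _ dflt) => // i lti; have lti' := lti; rewrite eq_size in lti'.
have eq_sort : sort_of (nth dflt ts i) = sort_of (nth dflt ts' i).
  by rewrite (sort_of_arg ws) // (sort_of_arg wt).
apply: (IH i lti _ _ _ _ _ eq_sort).
- exact: well_sorted_arg ws _ _.
- exact: well_sorted_arg wt _ _.
- by case/andP: ds => _ /(all_nthP dflt); apply.
- by case/andP: dt => _ /(all_nthP dflt); apply.
- by move=> z; rewrite (occurs_arg _ ws) // (occurs_arg _ wt) // eq_sort eq_occ.
Qed.

(** * Reaching a decreasing term *)

(** Sends a sort to the first term of that sort in ts, and a sort absent from ts
    to its own variable, which keeps the substitution sort-preserving. *)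
Definition assign ts V : raw_term T :=
  nth (Var V) ts (index V (map sort_of ts)).

Lemma assign_sort_preserving ts :
  all (well_sorted E) ts -> sort_preserving E (assign ts).
Proof.
move=> /(all_nthP dflt) wts V cV; rewrite /assign.
have [V_ts|/memNindex->] := boolP (V \in map sort_of ts); last first.
  by rewrite size_map nth_default.
have ltV : index V (map sort_of ts) < size ts.
  by rewrite -(size_map sort_of) index_mem.
rewrite (set_nth_default dflt) //; split; first exact: wts.
by rewrite -(nth_map dflt V) // nth_index.
Qed.

Lemma assign_sorts ts :
  uniq (map sort_of ts) -> map (assign ts) (map sort_of ts) = ts.
Proof.
move=> uts; apply: (@eq_from_nth _ dflt) => [|i]; rewrite !size_map // => lti.
rewrite (nth_map set0) ?size_map // /assign index_uniq ?size_map //.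
exact: set_nth_default.
Qed.

(** The left-hand side is linear: the sorts of its variables are pairwise
    distinct, so one substitution can pick all the arguments at once. *)
Lemma redex_match x K ts i y Z us :
  well_sorted E (App x K ts) -> i < size ts -> nth dflt ts i = App y Z us ->
  exists2 sigma, sort_preserving E sigma
    & App x K ts = subst sigma (rule_side E K x y).
Proof.
move=> wt lti eq_i; have wi := well_sorted_arg wt lti.
have XZ := arg_component wt lti; rewrite eq_i /= in wi XZ.
have /and4P[_ _ _ wts] := wt; have /and4P[_ Zy _ wus] := wi.
exists (assign (us ++ ts)).
  by apply: assign_sort_preserving; rewrite all_cat wus.
(* The sorts of us lie inside Z and miss y, so none is a component of K \ {x}. *)
have us_fresh : uniq (map sort_of (us ++ ts)).
  rewrite map_cat cat_uniq (args_sorts wi) (args_sorts wt) !component_seq_uniq.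
  rewrite andbT /=; apply/hasPn => B; rewrite !mem_component_seqE => XB.
  apply/negP => ZB; have /subsetD1P[sBZ] := components_sub ZB.
  have /set0Pn[v Bv] : B != set0.
    by apply: contraTneq ZB => ->; have /and3P[] := components_partition E0 (Z :\ y).
  by rewrite (components_meet E0 XB XZ Bv (subsetP sBZ v Bv)) Zy.
have := assign_sorts us_fresh; set sigma := assign _; rewrite !map_cat.
move/(congr1 (fun l => (take (size us) l, drop (size us) l))) => [].
rewrite !take_size_cat ?size_map // !drop_size_cat ?size_map // => def_us def_ts.
rewrite /= -map_comp; congr App; apply: (@eq_from_nth _ dflt) => [|j ltj].
  by rewrite size_map (args_size wt).
rewrite (nth_map set0) -?(args_size wt) // -(sort_of_arg wt ltj) /=.
case: ifP => [yj|_]; last first.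
  by rewrite -{1}def_ts (nth_map set0) ?size_map // (nth_map dflt).
have <- : i = j by apply: (arg_unique wt lti ltj _ yj); rewrite eq_i.
by rewrite eq_i /= -map_comp -(args_sorts wi); congr App; exact: esym def_us.
Qed.

Lemma nondecreasing_redex t : well_sorted E t -> ~~ decreasing t ->
  exists l r sigma (C : context T),
    [/\ rule E l r, sort_preserving E sigma & t = plug C (subst sigma l)].
Proof.
elim/raw_term_nth_ind: t => //= x K ts IH wt.
rewrite negb_and orbC -!has_predC => /orP[] /(has_nthP dflt)[i lti /= ndi].
  have [l [r [sigma [C [lr sP eq_i]]]]] := IH i lti (well_sorted_arg wt lti) ndi.
  exists l, r, sigma, (CApp x K (take i ts) C (drop i.+1 ts)); split=> //=.
  by rewrite -eq_i -drop_nth // cat_take_drop.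
have XZ := arg_component wt lti; have := well_sorted_arg wt lti.
case eq_i: (nth dflt ts i) ndi => [//|y Z us] /= le_xy /and4P[_ Zy _ _].
have [sigma sP ->] := redex_match wt lti eq_i.
have /and4P[cK Kx _ _] := wt; rewrite eq_i /= in XZ.
have /setD1P[neq Ky] := subsetP (components_sub XZ) y Zy.
exists (rule_side E K x y), (rule_side E K y x), sigma, (Hole T); split=> //.
by constructor; rewrite // lt_neqAle eq_sym neq leNgt.
Qed.

Lemma reach_decreasing (t : term E) :
  exists2 u, clos_refl_trans _ (@step d T E) t u & decreasing (sval u).
Proof.
have [n] := ubnP (weight (sval t)); elim: n t => // n IHn t; rewrite ltnS => le_tn.
have [dt|ndt] := boolP (decreasing (sval t)); first by exists t => //; apply: rt_refl.
have [l [r [sigma [C [lr sP eq_t]]]]] := nondecreasing_redex (valP t) ndt.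
have wt := valP t; rewrite /= eq_t in wt.
pose t' : term E := Sub (plug C (subst sigma r)) (well_sorted_rewrite lr sP wt).
have st : step t t' by exists l, r, sigma, C; split.
have [u tu du] := IHn t' (leq_trans (weight_step st) le_tn).
by exists u => //; apply: rt_trans tu; apply: rt_step.
Qed.

(** * Confluence and termination *)

Lemma step_confluent : confluent (@step d T E).
Proof.
move=> s t1 t2 st1 st2.
have [u1 tu1 d1] := reach_decreasing t1; have [u2 tu2 d2] := reach_decreasing t2.
have [so1 oc1] := steps_invariant (rt_trans _ _ _ _ _ st1 tu1).
have [so2 oc2] := steps_invariant (rt_trans _ _ _ _ _ st2 tu2).
have eq_u : u1 = u2.
  apply: val_inj; apply: decreasing_unique d1 d2 _ _.
  - exact: valP u1.
  - exact: valP u2.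
  - by rewrite -so1 so2.
  - by move=> z; rewrite -oc1 oc2.
by exists u1 => //; rewrite eq_u.
Qed.

Lemma step_terminating : terminating (@step d T E).
Proof.
case=> f f_step.
suff le_weight n : weight (sval (f n)) + n <= weight (sval (f 0)).
  have := le_weight (weight (sval (f 0))).+1.
  by rewrite leqNgt ltn_addl.
elim: n => [|n IHn]; first by rewrite addn0.
by apply: leq_trans IHn; rewrite addnS -addSn leq_add2r; apply: weight_step.
Qed.

End Terms.

Theorem theorem3p25 (d : Order.disp_t) (T : finOrderType d)
    (E : {set {set T}})
    (hypE : hypergraph E) (atomicE : atomic E)
    (connE : connected [set: T] E) :
  confluent (@step d T E) /\ terminating (@step d T E).
Proof.
by have [E0 _] := hypE; split; [apply: step_confluent | apply: step_terminating].
Qed.
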